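(* Let $H \in C^1\big((\mathbb{R}^N\otimes\mathbb{R}^n)\times\mathbb{R}^N\times\mathbb{R}^n\big)$ with $H\geq 0$, and write $H=H(P,\eta,x)$. Suppose that $u:\mathbb{R}^n\to\mathbb{R}^N$ is an Absolutely Minimizing Map for the supremal functional $$E_\infty(u,\Omega)=\operatorname*{ess\,sup}_{x\in\Omega} H\big(Du(x),u(x),x\big),\qquad \Omega\subseteq\mathbb{R}^n,$$ and that moreover $u\in C^2(\mathbb{R}^n)^N$. Then $u$ solves on $\mathbb{R}^n$ the tangential Aronsson PDE system: for every $\alpha\in\{1,\dots,N\}$, $$\Big(H_{P_{\alpha i}}(Du,u,\cdot)\,H_{P_{\beta j}}(Du,u,\cdot)\Big)D^2_{ij}u_\beta \;+\; H_{P_{\alpha i}}(Du,u,\cdot)\Big(H_{\eta_\beta}(Du,u,\cdot)\,D_iu_\beta+H_{x_i}(Du,u,\cdot)\Big)=0 .$$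
   Context: $\mathbb{R}^N\otimes\mathbb{R}^n$ is the space of $N\times n$ real matrices $P=(P_{\alpha i})$, $1\le\alpha\le N$, $1\le i\le n$. $Du=(D_iu_\alpha)$ is the gradient matrix of $u$, and $D^2_{ij}u_\beta$ are its second partial derivatives. Subscripts of $H$ denote partial derivatives ($H_{P_{\alpha i}}=\partial H/\partial P_{\alpha i}$, $H_{\eta_\beta}=\partial H/\partial\eta_\beta$, $H_{x_i}=\partial H/\partial x_i$), and $H_P(Du,u,\cdot)$ denotes the function $x\mapsto H_P(Du(x),u(x),x)$, and similarly for the others. Repeated indices are summed (Greek from $1$ to $N$, Latin from $1$ to $n$). Definition (Absolutely Minimizing Map): a map $u\in W^{1,\infty}_{loc}(\mathbb{R}^n)^N$ is Absolutely Minimizing for $E_\infty$ if for all open $\Omega\subset\subset\mathbb{R}^n$ (i.e. bounded open sets) and all $g\in W^{1,\infty}_0(\Omega)^N$ one has $E_\infty(u,\Omega)\le E_\infty(u+g,\Omega)$. *)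

(* Defs.v *)
From HB Require Import structures.
From mathcomp Require Import all_boot all_order all_algebra.
From mathcomp Require Import all_classical all_reals all_analysis.
From mathcomp Require Import ess_sup_inf.

Set Implicit Arguments.
Unset Strict Implicit.
Unset Printing Implicit Defensive.
Import Order.TTheory GRing.Theory Num.Theory.
Import numFieldNormedType.Exports.

Local Open Scope classical_set_scope.
Local Open Scope ring_scope.

(* The sigma-algebra on row vectors generated by the coordinates, i.e. the
   Borel sigma-algebra. *)
Fact rV_display : measure_display. Proof. exact: default_measure_display. Qed.

Section measurable_rV.
Context {R : realType} (n : nat).

Definition rV_coord_preimage : set (set 'rV[R]_n) :=
  [set A | exists i : 'I_n, exists2 B : set (measurableTypeR R),
     measurable B & A = (fun x : 'rV[R]_n => x ord0 i) @^-1` B].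

Let rV_meas0 : <<s rV_coord_preimage >> set0.
Proof. exact: sigma_algebra0. Qed.

Let rV_measC A : <<s rV_coord_preimage >> A -> <<s rV_coord_preimage >> (~` A).
Proof. exact: sigma_algebraC. Qed.

Let rV_measU (F : (set 'rV[R]_n)^nat) :
  (forall i, <<s rV_coord_preimage >> (F i)) ->
  <<s rV_coord_preimage >> (\bigcup_i F i).
Proof. exact: sigma_algebra_bigcup. Qed.

HB.instance Definition _ := @isMeasurable.Build rV_display 'rV[R]_n
  <<s rV_coord_preimage >> rV_meas0 rV_measC rV_measU.

Lemma measurable_rV_coord (i : 'I_n) :
  measurable_fun [set: 'rV[R]_n]
    (fun x : 'rV[R]_n => x ord0 i : measurableTypeR R).
Proof.
move=> _ B mB; rewrite setTI; apply: sub_sigma_algebra.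
by exists i; exists B.
Qed.

Lemma measurable_fun_rV d (T : measurableType d) (f : T -> 'rV[R]_n) :
  (forall i, measurable_fun [set: T]
     (fun t => f t ord0 i : measurableTypeR R)) ->
  measurable_fun [set: T] f.
Proof.
move=> mf; apply: (@measurability _ _ _ _ _ _ rV_coord_preimage) => //.
move=> _ [_ [i [B mB ->]] <-].
exact: (mf i measurableT B mB).
Qed.

End measurable_rV.

Section lebesgue_rV.
Context {R : realType}.

Definition rV_cons n (p : measurableTypeR R * 'rV[R]_n) : 'rV[R]_n.+1 :=
  row_mx (const_mx p.1 : 'rV[R]_1) p.2.

Definition rV_uncons n (v : 'rV[R]_n.+1) : measurableTypeR R * 'rV[R]_n :=
  (v ord0 ord0, @rsubmx R 1 1 n v).

Lemma rV_consK n : cancel (@rV_cons n) (@rV_uncons n).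
Proof.
move=> [x v]; rewrite /rV_uncons /rV_cons /= row_mxKr; congr pair.
have := row_mxEl (const_mx x : 'rV[R]_1) v ord0 ord0; rewrite [RHS]mxE => h; rewrite -{2}h.
by congr (row_mx _ _ _ _); exact/val_inj.
Qed.

Lemma measurable_rV_cons n : measurable_fun setT (@rV_cons n).
Proof.
apply: measurable_fun_rV => i; rewrite /rV_cons.
case: (@split_ordP 1 n i) => j ->.
  rewrite (_ : (fun _ => _) = fst)//.
  apply/funext => t.
  transitivity ((const_mx t.1 : 'rV[R]_1) ord0 j); last by rewrite mxE.
  exact: row_mxEl.
rewrite (_ : (fun _ => _) = (fun v : 'rV[R]_n => v ord0 j) \o snd).
  apply: measurableT_comp; first exact: measurable_rV_coord.
  exact: measurable_snd.
by apply/funext => t; exact: row_mxEr.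
Qed.

Lemma measurable_rV_uncons n : measurable_fun setT (@rV_uncons n).
Proof.
apply: measurable_fun_pair; first exact: measurable_rV_coord.
apply: measurable_fun_rV => i.
rewrite (_ : (fun _ => _) =
  (fun v : 'rV[R]_(1 + n) => v ord0 (rshift 1 i) : measurableTypeR R)).
  exact: measurable_rV_coord.
by apply/funext => t; rewrite mxE.
Qed.

Section step.
Variables (n : nat) (m : {sigma_finite_measure set 'rV[R]_n -> \bar R}).

Definition lebesgue_rV_step : set 'rV[R]_n.+1 -> \bar R :=
  pushforward (@lebesgue_measure R \x m)%E (@rV_cons n).

Let step0 : lebesgue_rV_step set0 = 0%E.
Proof. by rewrite /lebesgue_rV_step /pushforward preimage_set0 measure0. Qed.

Let step_ge0 A : (0 <= lebesgue_rV_step A)%E.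
Proof. by rewrite /lebesgue_rV_step /pushforward measure_ge0. Qed.

Let step_sigma_additive : semi_sigma_additive lebesgue_rV_step.
Proof.
pose mf := @measurable_rV_cons n.
move=> F mF tF mUF; rewrite /lebesgue_rV_step /pushforward preimage_bigcup.
apply: measure_semi_sigma_additive.
- by move=> k; rewrite -[X in measurable X]setTI; exact: mf.
- apply/trivIsetP => /= i j _ _ ij; rewrite -preimage_setI.
  by move/trivIsetP : tF => /(_ _ _ _ _ ij) ->//; rewrite preimage_set0.
- by rewrite -preimage_bigcup -[X in measurable X]setTI; exact: mf.
Qed.

HB.instance Definition _ := isMeasure.Build _ _ _ lebesgue_rV_step
  step0 step_ge0 step_sigma_additive.

Let step_sigma_finite : sigma_finite setT lebesgue_rV_step.
Proof.
pose L : {sigma_finite_measure set (measurableTypeR R) -> \bar R} :=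
  @lebesgue_measure R.
have /sigma_finiteP[F [TF ndF Foo]] := sigma_finiteT L.
have /sigma_finiteP[G [TG ndG Goo]] := sigma_finiteT m.
exists (fun k => @rV_uncons n @^-1` (F k `*` G k)).
  rewrite -preimage_bigcup (_ : \bigcup_k _ = setT) ?preimage_setT//.
  rewrite -setXTT TF TG predeqE => -[x y]; split.
    by move=> [k _ [/= Fx Gy]]; split; exists k.
  move=> [/= [j _ Fjx] [k _ Gky]]; exists (maxn j k) => //; split.
    by move: x Fjx; exact/subsetPset/ndF/leq_maxl.
  by move: y Gky; exact/subsetPset/ndG/leq_maxr.
move=> k; have [mF Fk] := Foo k; have [mG Gk] := Goo k; split.
  rewrite -[X in measurable X]setTI; apply: measurable_rV_uncons => //.
  exact: measurableX.
rewrite /lebesgue_rV_step /pushforward -comp_preimage.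
rewrite (_ : @rV_uncons n \o @rV_cons n = id).
  by rewrite (product_measure1E L m)// lte_mul_pinfty// ge0_fin_numE.
by apply/funext => p; exact: rV_consK.
Qed.

HB.instance Definition _ := @Measure_isSigmaFinite.Build _ _ _
  lebesgue_rV_step step_sigma_finite.

End step.

(* Lebesgue measure on R^n as an iterated product of the one-dimensional
   Lebesgue measure; on R^0 it is the Dirac mass. *)
Fixpoint lebesgue_rV n : {sigma_finite_measure set 'rV[R]_n -> \bar R} :=
  match n with
  | 0%N => \d_(0 : 'rV[R]_0)
  | n'.+1 => lebesgue_rV_step (lebesgue_rV n')
  end.

End lebesgue_rV.

(* f is of class C^k: Frechet differentiable with D_v f of class C^(k-1) for
   every direction v (on a finite-dimensional space this is the same as
   continuity of the map x |-> Df(x) into the linear maps, for k = 1). *)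
Fixpoint Ck (R : realType) (V W : normedModType R) (k : nat) (f : V -> W) :
    Prop :=
  match k with
  | 0%N => continuous f
  | k'.+1 => (forall x, differentiable f x) /\
             (forall v : V, Ck k' (fun x => 'D_v f x))
  end.

Section sobolev.
Context {R : realType} {n : nat}.
Local Notation Rn := 'rV[R]_n.
Local Notation mu := (@lebesgue_rV R n).
Implicit Types (Omega : set Rn) (f h : Rn -> R).

Definition basis_vec (i : 'I_n) : Rn := delta_mx ord0 i.

(* The values outside Omega are replaced by -oo, hence do not contribute. *)
Definition ess_sup_on Omega f : \bar R :=
  ess_sup mu (patch (cst -oo%E) Omega (EFin \o f)).

Definition Linfty Omega f : Prop :=
  measurable_fun Omega (f : Rn -> measurableTypeR R) /\
  (ess_sup_on Omega (fun x => `|f x|%R) < +oo)%E.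

Definition test_function Omega (phi : Rn -> R) : Prop :=
  (forall k, Ck k (phi : Rn -> R^o)) /\
  exists2 K : set Rn, compact K /\ K `<=` Omega &
    forall x, ~ K x -> phi x = 0.

Definition weak_partial Omega (i : 'I_n) f h : Prop :=
  forall phi, test_function Omega phi ->
    \int[mu]_(x in Omega) (f x * 'D_(basis_vec i) phi x) =
    - \int[mu]_(x in Omega) (h x * phi x).

Definition bounded_open Omega : Prop := open Omega /\ bounded_set Omega.

Section maps.
Context {N : nat}.
Implicit Types (u g : Rn -> 'rV[R]_N) (U : Rn -> 'M[R]_(N, n)).

(* U is (a version of) the weak gradient (D_i u_alpha) of u on Omega; it is
   required to be in L^oo(Omega), and it is unique up to null sets. *)
Definition weak_gradient Omega u U : Prop :=
  forall (alpha : 'I_N) (i : 'I_n),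
    Linfty Omega (fun x => U x alpha i) /\
    weak_partial Omega i (fun x => u x ord0 alpha) (fun x => U x alpha i).

Definition W1infty Omega u : Prop :=
  (forall alpha : 'I_N, Linfty Omega (fun x => u x ord0 alpha)) /\
  exists U, weak_gradient Omega u U.

Definition W1infty_loc u : Prop :=
  forall Omega, bounded_open Omega -> W1infty Omega u.

(* W^{1,oo}_0(Omega): the maps of W^{1,oo}(Omega) having a continuous
   representative which vanishes on the boundary of Omega, encoded as the
   continuity on R^n of the extension by zero. *)
Definition W1infty0 Omega g : Prop :=
  W1infty Omega g /\
  exists g0 : Rn -> 'rV[R]_N,
    [/\ continuous g0, (forall x, ~ Omega x -> g0 x = 0) &
        {ae mu, forall x, Omega x -> g x = g0 x}].

(* E_oo(u, Omega); the argument Du stands for the weak gradient of u, on whose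
   choice up to a null set the value does not depend. *)
Definition E_infty (H : 'M[R]_(N, n) * 'rV[R]_N * 'rV[R]_n -> R)
    u (Du : Rn -> 'M[R]_(N, n)) Omega : \bar R :=
  ess_sup_on Omega (fun x => H (Du x, u x, x)).

Definition absolutely_minimizing
    (H : 'M[R]_(N, n) * 'rV[R]_N * 'rV[R]_n -> R) u : Prop :=
  W1infty_loc u /\
  forall Omega, bounded_open Omega -> forall g, W1infty0 Omega g ->
    forall Du Dug, weak_gradient Omega u Du ->
      weak_gradient Omega (fun x => u x + g x)%R Dug ->
      (E_infty H u Du Omega <= E_infty H (fun x => u x + g x)%R Dug Omega)%E.

Definition gradient u (x : Rn) : 'M[R]_(N, n) :=
  \matrix_(alpha, i) 'D_(basis_vec i) (fun y => u y ord0 alpha) x.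

Definition hessian u (i j : 'I_n) (beta : 'I_N) (x : Rn) : R :=
  'D_(basis_vec i) (fun y => 'D_(basis_vec j) (fun z => u z ord0 beta) y) x.

End maps.
End sobolev.

Section partials.
Context {R : realType} {n N : nat}.
Variable H : 'M[R]_(N, n) * 'rV[R]_N * 'rV[R]_n -> R.

Definition H_P (alpha : 'I_N) (i : 'I_n)
    (q : 'M[R]_(N, n) * 'rV[R]_N * 'rV[R]_n) : R :=
  'D_(delta_mx alpha i) (fun P => H (P, q.1.2, q.2)) q.1.1.

Definition H_eta (beta : 'I_N)
    (q : 'M[R]_(N, n) * 'rV[R]_N * 'rV[R]_n) : R :=
  'D_(basis_vec beta) (fun eta => H (q.1.1, eta, q.2)) q.1.2.

Definition H_x (i : 'I_n)
    (q : 'M[R]_(N, n) * 'rV[R]_N * 'rV[R]_n) : R :=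
  'D_(basis_vec i) (fun x => H (q.1.1, q.1.2, x)) q.2.

End partials.

(* Main.v *)
Require Import Defs.
From mathcomp Require Import all_boot all_order all_algebra.
From mathcomp Require Import all_classical all_reals all_analysis.
Import numFieldNormedType.Exports.
Local Open Scope classical_set_scope.
Local Open Scope ring_scope.
From mathcomp Require Import ess_sup_inf measurable_realfun ring lra.
Import Order.TTheory GRing.Theory Num.Theory.
Set Implicit Arguments.
Unset Strict Implicit.
Unset Printing Implicit Defensive.

(* Put h := H(Du, u, .), which is of class C^1, and a := H_{P_alpha}(Du, u, .);
   the claim is that the derivative of h along a vanishes everywhere.  If not,
   then for a sign c the derivative of h along c a is positive on a small closed
   Euclidean ball around x.  At a maximum point y of h on this ball, c a(y)
   points strictly outwards, since otherwise h would increase along an inward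
   direction close to c a(y).  Let phi := r^2 - |. - x|^2 and
   g := c phi e_alpha.  At such y we have phi(y) = 0, so the derivative in t
   at t = 0 of H(Du + t Dg, u + t g, .) is c a(y) . Dphi(y) < 0.  By compactness
   (Danskin) some t > 0 satisfies H(Du + t Dg, u + t g, .) < max h on the whole
   closed ball, against minimality.  Since minimality is tested with weak
   gradients, the classical gradient of a C^1 map has to be identified with
   the weak one. *)

(** * Borel sets and Lebesgue measure on row vectors *)

Section rV_topology.
Context {R : realType} {n : nat}.
Implicit Types (A : set 'rV[R]_n) (f : 'rV[R]_n -> R).

Lemma rV_ballP (x y : 'rV[R]_n) (e : R) : 0 < e ->
  ball x e y <-> forall i, `|x ord0 i - y ord0 i| < e.
Proof.
move=> e0; split => [[_ h] i|h]; first exact: h.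
by split => // i j; rewrite ord1; exact: h.
Qed.

(** Balls of the sup norm are cubes, that is, finite intersections of coordinate preimages of
    intervals. For e <= 0 the ball is empty, since membership in it includes 0 < e. *)
Lemma measurable_rV_ball (x : 'rV[R]_n) (e : R) : measurable (ball x e).
Proof.
have [e0|e0] := ltP 0 e; last first.
  rewrite (_ : ball x e = set0)// -subset0 => y [].
  by rewrite ltNge e0.
rewrite (_ : ball x e = \bigcap_(i in [set: 'I_n])
    ((fun y : 'rV[R]_n => y ord0 i) @^-1` (ball (x ord0 i) e))).
  apply: fin_bigcap_measurable => // i _; rewrite -[X in measurable X]setTI.
  apply: measurable_rV_coord => //.
  by apply: open_measurable; exact: ball_open.
apply/seteqP; split => y.
  by move=> /(rV_ballP _ _ e0) h i _; exact: h.
by move=> h; apply/rV_ballP => // i; exact: (h i).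
Qed.

(** The sigma-algebra is generated by coordinate preimages, so A is exhibited as the countable union
    of the cubes with rational centre and radius 1 / (m + 1) that it contains. *)
Lemma open_measurable_rV A : open A -> measurable A.
Proof.
move=> oA.
pose B (p : 'rV[rat]_n * nat) : set 'rV[R]_n :=
  ball (map_mx (@ratr R) p.1) p.2.+1%:R^-1.
pose F p := if pselect (B p `<=` A) then B p else set0.
suff AF : A = \bigcup_p F p.
  rewrite AF.
  apply: countable_bigcupT_measurable => // p; rewrite /F.
  by case: (pselect (B p `<=` A)) => pB /=;
    [exact: measurable_rV_ball|exact: measurable0].
apply/seteqP; split => [x Ax|x [p _]]; last first.
  by rewrite /F; case: (pselect (B p `<=` A)) => h /=; [exact: h|by []].
have : nbhs x A by apply: open_nbhs_nbhs; split.
move=> /nbhs_ballP[e /= e0 eA].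
have e20 : 0 < e / 2 by rewrite divr_gt0.
(* The radius 1 / (m + 1) is below e / 2 and the rational centre is within that radius of x, so the
   cube contains x and stays inside [ball x e]. *)
have [m _ /(_ _ (leqnn m)) /= me] := near_infty_natSinv_lt (PosNum e20).
have m0 : 0 < m.+1%:R^-1 :> R by rewrite invr_gt0 ltr0n.
have /choice[q qx] : forall i : 'I_n, exists q : rat,
    `|ratr q - x ord0 i| < m.+1%:R^-1.
  move=> i.
  have : x ord0 i - m.+1%:R^-1 < x ord0 i + m.+1%:R^-1.
    by rewrite ltrD2l (lt_trans _ m0)// oppr_lt0.
  move=> /rat_in_itvoo[q]; rewrite in_itv/= => /andP[h1 h2]; exists q.
  by rewrite ltr_distl h1.
exists (\row_i q i, m) => //; rewrite /F; case: (pselect (B _ `<=` A)) =>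
  [pB|[]] /=.
  by apply/rV_ballP => //= i; rewrite !mxE.
move=> y /rV_ballP-/(_ m0) /= h; apply: eA; apply/rV_ballP => // i.
have := h i; have := qx i; rewrite !mxE => h1 h2.
rewrite (le_lt_trans (ler_distD (ratr (q i)) _ _))//.
by rewrite (splitr e) ltrD// (lt_trans _ me)// distrC.
Qed.

Lemma continuous_measurable_rV f : continuous f ->
  measurable_fun setT (f : _ -> measurableTypeR R).
Proof.
move=> cf; apply: (measurability _ (RGenOpens.measurableE R)) => _ [_ [a [b ->]
  <-]].
by apply: measurableI => //; apply: open_measurable_rV;
  apply: open_comp => // x _; exact: cf.
Qed.

Lemma le_norm_coord (x : 'rV[R]_n) i : `|x ord0 i| <= `|x|.
Proof.
rewrite [leRHS]/Num.Def.normr/= mx_normrE.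
exact: (le_bigmax _ (fun ij : 'I_1 * 'I_n => `|x ij.1 ij.2|) (ord0, i)).
Qed.

Lemma norm_rV_le (x : 'rV[R]_n) (b : R) : 0 <= b ->
  (forall i, `|x ord0 i| <= b) -> `|x| <= b.
Proof.
move=> b0 h; rewrite [leLHS]/Num.Def.normr/= mx_normrE.
by apply: bigmax_le => // -[j i] _; rewrite ord1; exact: h.
Qed.

End rV_topology.

(** Both difference quotients coincide, because [phi] carries the line through y along w affinely
    onto the line through [phi y] along v. This passes between a function and its slices. *)
Lemma derivable_comp_affine {R : realType} {U V W : normedModType R}
    (phi : U -> V) (f : V -> W) (y w : U) (v : V) :
  (forall h, phi (h *: w + y) = h *: v + phi y) ->
  derivable f (phi y) v -> derivable (f \o phi) y w.
Proof.
move=> phiE; rewrite /derivable/=.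
suff -> : (fun h : R => h^-1 *: (f (phi (h *: w + y)) - f (phi y))) =
  (fun h : R => h^-1 *: (f (h *: v + phi y) - f (phi y))) by [].
by apply/funext => h; rewrite phiE.
Qed.

Lemma derive_comp_affine {R : realType} {U V W : normedModType R}
    (phi : U -> V) (f : V -> W) (y w : U) (v : V) :
  (forall h, phi (h *: w + y) = h *: v + phi y) ->
  'D_w (f \o phi) y = 'D_v f (phi y).
Proof.
move=> phiE; rewrite /derive/=.
suff -> : (fun h : R => h^-1 *: (f (phi (h *: w + y)) - f (phi y))) =
  (fun h : R => h^-1 *: (f (h *: v + phi y) - f (phi y))) by [].
by apply/funext => h; rewrite phiE.
Qed.

Lemma nonexpansive_continuous {R : realType} {V W : normedModType R} (f : V ->
  W) :
  (forall x y, `|f x - f y| <= `|x - y|) -> continuous f.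
Proof.
move=> h x; apply/cvgrPdist_lt => e e0; near=> y.
by rewrite (le_lt_trans (h _ _))//; near: y; apply/nbhs_normP; exists e.
Unshelve. all: by end_near. Qed.

Section lebesgue_rV_lemmas.
Context {R : realType}.

Lemma rV_cons_ord0 n (p : measurableTypeR R * 'rV[R]_n) :
  rV_cons p ord0 ord0 = p.1.
Proof. by case: p => x v; have [] := rV_consK (x, v). Qed.

Lemma rV_cons_lift n (p : measurableTypeR R * 'rV[R]_n) j :
  rV_cons p ord0 (lift ord0 j) = p.2 ord0 j.
Proof.
have <- := row_mxEr (const_mx p.1 : 'rV[R]_1) p.2 ord0 j.
by congr (row_mx _ _ _ _); exact/val_inj.
Qed.

Lemma eq_rV_cons n (u v : 'rV[R]_n.+1) : u ord0 ord0 = v ord0 ord0 ->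
  (forall j, u ord0 (lift ord0 j) = v ord0 (lift ord0 j)) -> u = v.
Proof.
by move=> h0 hS; apply/rowP => i; case: (unliftP ord0 i) => [j|] ->.
Qed.

Lemma norm_rV_cons_l n (p : measurableTypeR R * 'rV[R]_n) :
  `|p.1 : R| <= `|rV_cons p|.
Proof. by have := le_norm_coord (rV_cons p) ord0; rewrite rV_cons_ord0. Qed.

Lemma norm_rV_cons_r n (p : measurableTypeR R * 'rV[R]_n) :
  `|p.2| <= `|rV_cons p|.
Proof.
apply: norm_rV_le => // i.
by have := le_norm_coord (rV_cons p) (lift ord0 i); rewrite rV_cons_lift.
Qed.

Lemma norm_rV_cons_le n (x : R) (v : 'rV[R]_n) :
  `|rV_cons (x, v)| <= Num.max `|x| `|v|.
Proof.
apply: norm_rV_le => [|i]; first by rewrite le_max normr_ge0.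
case: (unliftP ord0 i) => [j|] ->; rewrite ?rV_cons_ord0 ?rV_cons_lift le_max.
  by rewrite le_norm_coord orbT.
by rewrite lexx.
Qed.

Lemma rV_cons_scaleD n (h x y : R) (u v : 'rV[R]_n) :
  rV_cons (h *: x + y, h *: u + v) = h *: rV_cons (x, u) + rV_cons (y, v).
Proof.
apply: eq_rV_cons => [|j]; rewrite [RHS]mxE [X in _ = X + _]mxE.
  by rewrite !rV_cons_ord0.
by rewrite !rV_cons_lift !mxE.
Qed.

Lemma continuous_rV_cons_r n (x : R) :
  continuous (fun v : 'rV[R]_n => rV_cons (x, v)).
Proof.
apply: nonexpansive_continuous => v w.
have -> : rV_cons (x, v) - rV_cons (x, w) = rV_cons (0, v - w).
  by rewrite addrC -scaleN1r -rV_cons_scaleD !scaleN1r addNr addrC.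
by rewrite (le_trans (norm_rV_cons_le _ _))// normr0 ge_max normr_ge0/=.
Qed.
Lemma continuous_rV_cons_l n (v : 'rV[R]_n) :
  continuous (fun x : R => rV_cons (x, v)).
Proof.
apply: nonexpansive_continuous => x y.
have -> : rV_cons (x, v) - rV_cons (y, v) = rV_cons (x - y, 0).
  by rewrite addrC -scaleN1r -rV_cons_scaleD !scaleN1r addNr addrC.
by rewrite (le_trans (norm_rV_cons_le _ _))// normr0 ge_max normr_ge0 lexx.
Qed.

(** Induction on n: the preimage of a cube under [rV_cons] is an interval times a cube. The value
    serves twice, through its finiteness for integrability and through its positivity for essential
    suprema. *)
Lemma lebesgue_rV_ball n (x : 'rV[R]_n) (e : R) : 0 < e ->
  lebesgue_rV n (ball x e) = ((e *+ 2) ^+ n)%:E.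
Proof.
move=> e0; elim: n x => [|n IH] x.
  by rewrite /= diracE mem_set//; apply/rV_ballP => // -[].
rewrite /= /lebesgue_rV_step /pushforward.
have -> : @rV_cons R n @^-1` ball x e =
    ball (x ord0 ord0 : R) e `*` ball (\row_j x ord0 (lift ord0 j)) e.
  apply/seteqP; split => [[y v] /(rV_ballP _ _ e0) h|[y v]]; last first.
    move=> [/= h1 /(rV_ballP _ _ e0) h2]; apply/(rV_ballP _ _ e0) => i.
    case: (unliftP ord0 i) => [j|] ->; rewrite ?rV_cons_ord0 ?rV_cons_lift//.
    by have := h2 j; rewrite mxE.
  split => /=; first by have := h ord0; rewrite rV_cons_ord0.
  apply/(rV_ballP _ _ e0) => i.
  by have := h (lift ord0 i); rewrite rV_cons_lift mxE.
rewrite product_measure1E; last 2 first.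
- by apply: open_measurable; exact: ball_open.
- exact: measurable_rV_ball.
rewrite /= IH exprS EFinM; congr (_ * _)%E.
by apply: lebesgue_measure_ball; exact: ltW.
Qed.

End lebesgue_rV_lemmas.

(** * Integration by parts *)

Lemma compact_norm_le {R : realType} n (b : R) :
  compact [set x : 'rV[R]_n | `|x| <= b].
Proof.
apply: bounded_closed_compact.
  exists b; split => [|r br x /= xb]; first exact: num_real.
  by rewrite (le_trans xb)// ltW.
apply: (@closed_comp _ _ (fun x : 'rV[R]_n => `|x|) [set r | r <= b]).
  by move=> x _; exact: norm_continuous.
exact: closed_le.
Qed.

Section integral_rV.
Context {R : realType}.
Local Notation mu := (@lebesgue_rV R).

Lemma bounded_support_integrable n (f : 'rV[R]_n -> R) (b : R) :
  continuous f -> (forall x, b <= `|x| -> f x = 0) ->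
  (mu n).-integrable setT (EFin \o f).
Proof.
move=> cf f0.
(* The maximum with 1 keeps the radius positive even when b <= 0. *)
pose c := Num.max b 1; have c0 : 0 < c by rewrite lt_max ltr01 orbT.
have fE : f = f \_ (ball 0 c).
  apply/funext => x; rewrite patchE; case: ifPn => // /negP xc.
  rewrite f0// leNgt; apply/negP => xb; apply: xc; rewrite inE.
  apply/rV_ballP => // i; rewrite mxE sub0r normrN lt_max.
  by rewrite (le_lt_trans (le_norm_coord _ _) xb).
rewrite fE -restrict_EFin; apply/integrable_restrict => //.
  exact: measurable_rV_ball.
rewrite setTI; apply: measurable_bounded_integrable.
- exact: measurable_rV_ball.
- by rewrite [X in (X < _)%E](lebesgue_rV_ball (0 : ('rV[R]_n)) c0) ltry.
- by apply: measurable_funTS; exact: continuous_measurable_rV.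
have : bounded_set (f @` [set x | `|x| <= c]).
  apply: compact_bounded; apply: continuous_compact;
    last exact: compact_norm_le.
  by apply: continuous_subspaceT; exact: cf.
move=> [M [Mr hM]]; exists M; split => // r Mr' x /= /(rV_ballP _ _ c0) xc.
apply: hM Mr' _ _; exists x => //=; apply: norm_rV_le; first exact: ltW.
by move=> i; have := xc i; rewrite mxE sub0r normrN => /ltW.
Qed.

Lemma measurable_comp_rV_cons n (f : 'rV[R]_n.+1 -> R) : continuous f ->
  measurable_fun setT ((f : _ -> measurableTypeR R) \o @rV_cons R n).
Proof.
move=> cf; apply: measurableT_comp; last exact: measurable_rV_cons.
exact: continuous_measurable_rV.
Qed.

(** The change of variables for the nonnegative |f| carries integrability over to the product
    measure, as Fubini requires. *)
Lemma integrable_comp_rV_cons n (f : 'rV[R]_n.+1 -> R) (b : R) :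
  continuous f -> (forall x, b <= `|x| -> f x = 0) ->
  (@lebesgue_measure R \x mu n)%E.-integrable setT
    (EFin \o f \o @rV_cons R n).
Proof.
move=> cf f0; apply/integrableP; split.
  by apply/measurable_EFinP; exact: measurable_comp_rV_cons.
have /integrableP[mf] := bounded_support_integrable cf f0.
rewrite /= /lebesgue_rV_step ge0_integral_pushforward//.
- exact: measurable_rV_cons.
- by apply/measurable_EFinP; apply: measurableT_comp => //;
  exact: continuous_measurable_rV.
Qed.

Lemma integral_rV_cons n (f : 'rV[R]_n.+1 -> R) (b : R) :
  continuous f -> (forall x, b <= `|x| -> f x = 0) ->
  (\int[mu n.+1]_x (f x)%:E =
   \int[@lebesgue_measure R \x mu n]_p (f (rV_cons p))%:E)%E.
Proof.
move=> cf f0; rewrite /= /lebesgue_rV_step.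
rewrite integral_pushforward ?preimage_setT//.
- exact: measurable_rV_cons.
- by apply/measurable_EFinP; exact: continuous_measurable_rV.
- exact: integrable_comp_rV_cons f0.
Qed.

(** The margin 1 makes f vanish on a whole neighbourhood of x. *)
Lemma derive_bounded_support (V : normedModType R) (f : V -> R) (v : V) (b : R)
  :
  (forall x, b <= `|x| -> f x = 0) -> forall x, b + 1 <= `|x| -> 'D_v f x = 0.
Proof.
move=> f0 x xb.
have : \forall y \near x, f y = cst 0 y.
  near=> y; apply: f0.
  have : `|x - y| < 1 by near: y; apply/nbhs_normP; exists 1 => //=.
  have := ler_distD y x 0; rewrite !subr0; lra.
move=> /near_eq_derive h; have [->|v0] := eqVneq v 0; first exact: derive0.
by rewrite h// derive_cst.
Unshelve. all: by end_near. Qed.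

Lemma integral_derive_bounded_support (f : R -> R) (b : R) :
  (forall x, derivable f x 1) -> continuous ('D_1 f) ->
  (forall x, b <= `|x| -> f x = 0) ->
  (\int[lebesgue_measure]_x ('D_1 f x)%:E = 0)%E.
Proof.
move=> df cdf f0.
(* Since c >= b + 1, both f and its derivative vanish at distance at least c from 0, so the integral
   reduces to [-c, c] and the boundary values are 0; c > 0 keeps the interval nondegenerate. *)
pose c := Num.max b 0 + 1.
have bc : b + 1 <= c by rewrite lerD2r le_max lexx.
have c0 : 0 < c by rewrite ltr_wpDl// le_max lexx orbT.
have -> : (fun x => ('D_1 f x)%:E) = (fun x => ('D_1 f x)%:E) \_ `[-c, c].
  apply/funext => x; rewrite patchE; case: ifPn => // /negP xc.
  rewrite (derive_bounded_support (1 : R) f0)// (le_trans bc)//.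
  rewrite leNgt; apply/negP => /ltW; rewrite ler_norml => xc'; apply: xc.
  by rewrite inE/= in_itv.
rewrite -integral_mkcond.
have cf : continuous f.
  by move=> x; apply: differentiable_continuous; exact/derivable1_diffP.
rewrite (@continuous_FTC2 _ _ f).
- by rewrite !f0 ?subee// ?normrN; have := ler_norm c; lra.
- by rewrite gtrN.
- exact: continuous_subspaceT.
- split.
  + by move=> x _; exact: df.
  + by apply: cvg_at_right_filter; exact: cf.
  + by apply: cvg_at_left_filter; exact: cf.
- by move=> x _; rewrite derive1E.
Qed.

(* Fubini: integrate first in the direction of differentiation. *)
Lemma integral_partial_bounded_support n (i : 'I_n) (f : 'rV[R]_n -> R) (b : R)
  :
  (forall x, derivable f x (basis_vec i)) -> continuous ('D_(basis_vec i) f) ->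
  (forall x, b <= `|x| -> f x = 0) ->
  (\int[mu n]_x ('D_(basis_vec i) f x)%:E = 0)%E.
Proof.
elim: n i f => [[]//|n IH] i f df cdf f0.
have D0 := derive_bounded_support (basis_vec i) f0.
rewrite (integral_rV_cons cdf D0).
have intD := integrable_comp_rV_cons cdf D0.
(* In the head direction the inner integral over the first coordinate vanishes by the
   one-dimensional case; in a tail direction the inner integral over the other coordinates vanishes
   by induction. *)
case: (unliftP ord0 i) => [j|] iE; last first.
  rewrite -(integral21_prod_meas1 intD) -[RHS](integral0 (mu n) setT).
  apply: eq_integral => v _; rewrite /fubini_G/=.
  have aff x (h : R) : rV_cons (h *: (1 : R) + x, v) =
      h *: basis_vec i + rV_cons (x, v).
    apply: eq_rV_cons => [|k]; rewrite [RHS]mxE [X in _ = X + _]mxE.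
      by rewrite !rV_cons_ord0 iE /basis_vec mxE.
    rewrite !rV_cons_lift/= iE /basis_vec mxE eq_sym (negbTE (neq_lift _ _)).
    by rewrite mulr0 add0r.
  have dE x : 'D_1 (f \o (fun x : R => rV_cons (x, v))) x =
      'D_(basis_vec i) f (rV_cons (x, v)) by apply: derive_comp_affine.
  under eq_integral do rewrite -dE.
  apply: (@integral_derive_bounded_support _ b).
  - by move=> x; apply: derivable_comp_affine (aff x) _; exact: df.
  - move=> x; rewrite (funext dE).
    apply: (@continuous_comp _ _ _ (fun x : R => rV_cons (x, v))
      ('D_(basis_vec i) f)).
      exact: continuous_rV_cons_l.
    exact: cdf.
  - by move=> x bx; rewrite /= f0// (le_trans bx)//;
    exact: (norm_rV_cons_l (x, v)).
rewrite -(integral12_prod_meas1 intD) -[RHS](integral0 (@lebesgue_measure R)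
  setT).
apply: eq_integral => x _; rewrite /fubini_F/=.
have aff v (h : R) : rV_cons (x, h *: basis_vec j + v) =
    h *: basis_vec i + rV_cons (x, v).
  apply: eq_rV_cons => [|k]; rewrite [RHS]mxE [X in _ = X + _]mxE.
    rewrite !rV_cons_ord0 iE /basis_vec/= mxE (negbTE (neq_lift _ _)).
    by rewrite mulr0 add0r.
  by rewrite !rV_cons_lift/= /basis_vec !mxE iE (inj_eq lift_inj).
have dE v : 'D_(basis_vec j) (f \o (fun v => rV_cons (x, v))) v =
    'D_(basis_vec i) f (rV_cons (x, v)) by apply: derive_comp_affine.
under eq_integral do rewrite -dE.
apply: IH.
- by move=> v; apply: derivable_comp_affine (aff v) _; exact: df.
- move=> v; rewrite (funext dE).
  apply: (@continuous_comp _ _ _ (fun v : 'rV[R]_n => rV_cons (x, v))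
    ('D_(basis_vec i) f)).
    exact: continuous_rV_cons_r.
  exact: cdf.
- by move=> v bv; rewrite /= f0// (le_trans bv)//;
  exact: (norm_rV_cons_r (x, v)).
Qed.

End integral_rV.

(** * Classical and weak gradients *)

Section C1_rV.
Context {R : realType} {V : normedModType R} {N : nat}.
Implicit Types u : V -> 'rV[R]_N.

Lemma differentiable_rV_coord u x (k : 'I_N) :
  differentiable u x -> differentiable (fun y => u y ord0 k) x.
Proof.
move=> du; apply: (@differentiable_comp _ _ _ _ u (fun v : 'rV[R]_N => v ord0
  k)) => //.
exact: differentiable_coord.
Qed.

Lemma derive_rV_coord u x v (k : 'I_N) :
  differentiable u x -> 'D_v (fun y => u y ord0 k) x = 'D_v u x ord0 k.
Proof. by move=> du; rewrite derive_mx ?mxE//; exact: diff_derivable. Qed.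

Lemma Ck1_rV_coord u (k : 'I_N) : Ck 1 u -> Ck 1 (fun x => u x ord0 k : R^o).
Proof.
move=> [du cu]; split => [x|v x]; first exact: differentiable_rV_coord.
rewrite (_ : (fun x => _) = (fun M : 'rV[R]_N => M ord0 k) \o 'D_v u).
  by apply: continuous_comp; [exact: cu|exact: coord_continuous].
by apply/funext => y; rewrite derive_rV_coord.
Qed.

End C1_rV.

Section ess_sup_on.
Context {R : realType} {n : nat}.
Implicit Types (Omega : set 'rV[R]_n) (f : 'rV[R]_n -> R).

Lemma ess_sup_on_le Omega f (r : R) :
  (forall x, Omega x -> f x <= r) -> (ess_sup_on Omega f <= r%:E)%E.
Proof.
move=> h; apply/ess_supP; apply: aeW => x; rewrite /patch.
by case: ifPn => [/set_mem/h|_]; rewrite ?lee_fin// leNye.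
Qed.

(** If f x > r, then f > r on a ball inside Omega; that ball would lie in a null set although its
    measure is positive. *)
Lemma le_of_ess_sup_on Omega f (r : R) : open Omega -> continuous f ->
  (ess_sup_on Omega f <= r%:E)%E -> forall x, Omega x -> f x <= r.
Proof.
move=> oO cf /ess_supP[Z [mZ Z0 sZ]] x Ox; rewrite leNgt; apply/negP => rf.
have : nbhs x (Omega `&` [set y | r < f y]).
  apply: filterI; first by apply: open_nbhs_nbhs; split.
  by apply: (cf x [set y | r < y]); exact: lt_nbhsr.
move=> /nbhs_ballP[e /= e0 eA].
have eZ : ball x e `<=` Z.
  move=> y /eA[Oy ry]; apply: sZ => /=.
  by rewrite /patch mem_set//= lee_fin leNgt ry.
have := le_measure (lebesgue_rV n) _ _ eZ.
rewrite !inE => /(_ (measurable_rV_ball _ _) mZ).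
rewrite [X in (_ <= X)%E]Z0 [X in (X <= _)%E](lebesgue_rV_ball x e0) lee_fin
  leNgt.
by rewrite exprn_gt0// pmulrn_lgt0.
Qed.

Lemma continuous_Linfty Omega f : bounded_open Omega -> continuous f ->
  Linfty Omega f.
Proof.
move=> [oO [M [Mr hM]]] cf; split.
  by apply: measurable_funTS; exact: continuous_measurable_rV.
have : bounded_set (f @` [set x | `|x| <= M + 1]).
  apply: compact_bounded; apply: continuous_compact;
    last exact: compact_norm_le.
  by apply: continuous_subspaceT; exact: cf.
move=> [C [Cr hC]]; apply: (@le_lt_trans _ _ (C + 1)%:E); last exact: ltry.
apply: ess_sup_on_le => x Ox; apply: (hC (C + 1)); first by rewrite ltrDl.
exists x => //; apply: (hM (M + 1)) => //.
by rewrite ltrDl.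
Qed.

End ess_sup_on.

Section weak_C1.
Context {R : realType} {n : nat}.
Implicit Types (Omega : set 'rV[R]_n).

(** The product f phi is C^1 with bounded support, so the integral of its partial derivative, which
    is f D phi + phi D f, vanishes. *)
Lemma C1_weak_partial Omega (i : 'I_n) (f : 'rV[R]_n -> R) :
  Ck 1 (f : _ -> R^o) -> weak_partial Omega i f ('D_(basis_vec i) f).
Proof.
move=> [df cdf] phi [/(_ 1%N)[dphi cdphi] [K [cK KO] phi0]].
set v := basis_vec i.
have cf : continuous f by move=> x; exact: differentiable_continuous.
have cphi : continuous phi by move=> x; exact: differentiable_continuous.
have Dphi0 x : ~ K x -> 'D_v phi x = 0.
  move=> Kx; have : \forall y \near x, phi y = cst 0 y.
    have : nbhs x (~` K).
      apply: open_nbhs_nbhs; split => //; rewrite openC.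
      exact: compact_closed.
    by apply: filterS => y; exact: phi0.
  move=> /near_eq_derive h; have [->|v0] := eqVneq v 0; first exact: derive0.
  by rewrite h// derive_cst.
have [M [Mr hM]] := compact_bounded cK.
(* Boundedness gives |x| <= s on K only for s > M; the choice s = M + 1/2 separates K from the
   region M + 1 <= |x|. *)
have KM x : M + 1 <= `|x| -> ~ K x.
  move=> xM Kx; have : `|x| <= M + 2^-1 by apply: (hM (M + 2^-1)) => //;
    rewrite ltrDl.
  lra.
(* As K lies in Omega, products with a factor vanishing off K can be integrated over the whole space
   instead of Omega. *)
have extend (g psi : 'rV[R]_n -> R) : (forall x, ~ K x -> psi x = 0) ->
    (fun x => g x * psi x) \_ Omega = (fun x => g x * psi x).
  move=> psi0; apply/funext => x; rewrite patchE; case: ifPn => // /negP Ox.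
  by rewrite psi0 ?mulr0// => /KO Kx; apply: Ox; rewrite inE.
have integ (g psi : 'rV[R]_n -> R) : continuous g -> continuous psi ->
    (forall x, ~ K x -> psi x = 0) ->
    (lebesgue_rV n).-integrable setT (EFin \o (fun x => g x * psi x)).
  move=> cg cpsi psi0; apply: (@bounded_support_integrable _ _ _ (M + 1)).
    by move=> x; exact: (continuousM (cg x) (cpsi x)).
  by move=> x /KM /psi0 ->; rewrite mulr0.
rewrite Rintegral_mkcond [in RHS]Rintegral_mkcond !extend//.
apply/eqP; rewrite -subr_eq0 opprK -RintegralD//; last 2 first.
- by apply: integ => //; exact: cdphi.
- by apply: integ => //; exact: cdf.
have fphiE x : 'D_v (fun x => f x * phi x) x = f x * 'D_v phi x + 'D_v f x *
  phi x.
  rewrite (@deriveM _ _ f phi); [|exact: diff_derivable..].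
  by rewrite /GRing.scale/= [phi x * _]mulrC.
rewrite /Rintegral; under eq_integral do rewrite -fphiE.
rewrite (@integral_partial_bounded_support _ _ _ _ (M + 1))//.
- move=> x; apply: (@derivableM _ _ f phi); exact: diff_derivable.
- rewrite (funext fphiE) => x.
  exact: (continuousD (continuousM (cf x) (cdphi v x))
    (continuousM (cdf v x) (cphi x))).
- by move=> x /KM /phi0 ->; rewrite mulr0.
Qed.

Context {N : nat}.
Implicit Types u : 'rV[R]_n -> 'rV[R]_N.

Lemma C1_weak_gradient Omega u : bounded_open Omega -> Ck 1 u ->
  weak_gradient Omega u (gradient u).
Proof.
move=> bO uC1 k i.
rewrite (_ : (fun x => _) = 'D_(basis_vec i) (fun y => u y ord0 k)); last first.
  by apply/funext => x; rewrite mxE.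
have [_ cu] := Ck1_rV_coord k uC1.
split; first by apply: continuous_Linfty => //; exact: cu.
by apply: C1_weak_partial; exact: Ck1_rV_coord.
Qed.

Lemma C1_W1infty Omega u : bounded_open Omega -> Ck 1 u -> W1infty Omega u.
Proof.
move=> bO uC1; split; last by exists (gradient u); exact: C1_weak_gradient.
move=> k; apply: continuous_Linfty => // x; apply: differentiable_continuous.
by case: (Ck1_rV_coord k uC1).
Qed.

End weak_C1.

(** * Maxima under perturbation *)

Section matrix_valued.
Context {R : realType} {V : normedModType R} {m n : nat}.
Implicit Types f : V -> 'M[R]_(m, n).

Lemma continuous_mx f :
  (forall i j, continuous (fun x => f x i j)) -> continuous f.
Proof.
move=> cf x A [P MP sPA].
apply: (@filterS _ (nbhs x) _ [set y | forall i j, P i j (f y i j)]).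
  by move=> y Py; exact: sPA.
apply: filter_forall => i; apply: filter_forall => j.
by apply: cf; exact: MP.
Qed.

Lemma differentiable_mx f x :
  (forall i j, differentiable (fun y => f y i j) x) -> differentiable f x.
Proof.
move=> df.
have -> : f = \sum_(i < m) \sum_(j < n) (fun y => f y i j *: delta_mx i j).
  apply/funext => y; rewrite fct_sumE [LHS]matrix_sum_delta.
  by apply: eq_bigr => i _; rewrite fct_sumE.
apply: differentiable_sum => i; apply: differentiable_sum => j.
exact: differentiableZl.
Qed.

End matrix_valued.

Lemma near_right_gt {R : realType} {V : normedModType R} (f : V -> R) (y v : V)
  :
  differentiable f y -> 0 < 'd f y v ->
  \forall s \near 0^'+, f y < f (s *: v + y).
Proof.
move=> dfy; rewrite -deriveE// => fv.
have /cvg_ex[l hl] : derivable f y v by exact: diff_derivable.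
have lE : 'D_v f y = l by apply/cvg_lim.
rewrite lE in fv.
have : \forall s \near 0^', 0 < s^-1 *: (f (s *: v + y) - f y).
  by apply: (hl [set r | 0 < r]); exact: lt_nbhsr.
rewrite near_withinE => h0; rewrite near_withinE; near=> s => s0.
rewrite -subr_gt0 -(pmulr_rgt0 _ (_ : 0 < s^-1)) ?invr_gt0//.
by apply: (near h0 s) => //; rewrite gt_eqF.
Unshelve. all: by end_near. Qed.

Lemma cvg_ray {R : realType} {V : normedModType R} (y v : V) :
  s *: v + y @[s --> 0^'+] --> y.
Proof.
apply: cvg_at_right_filter; rewrite -[X in _ --> X]add0r -(scale0r v).
by apply: cvgD; [apply: cvgZr_tmp; exact: cvg_id|exact: cvg_cst].
Qed.

(* If [a] did not point strictly out of [0 <= phi] at [y], the perturbation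
   [a + d b] would point strictly inwards and increase [h]. *)
Lemma constrained_max_outward {R : realType} {V : normedModType R}
    (h phi : V -> R) (y a b : V) :
  differentiable h y -> differentiable phi y -> 0 <= phi y ->
  (forall z, 0 <= phi z -> h z <= h y) ->
  0 < 'd h y a -> (phi y = 0 -> 0 < 'd phi y b) ->
  phi y = 0 /\ 'd phi y a < 0.
Proof.
move=> dh dphi phi0 ymax ha phib.
(* A direction that increases h must leave the constraint set at once, as y is a maximum point. *)
have noray v : 0 < 'd h y v -> ~ \forall s \near 0^'+, 0 <= phi (s *: v + y).
  move=> hv ph; have [s [+ /ymax]] := filter_ex (filterI (near_right_gt dh hv)
    ph).
  by move=> /lt_le_trans h1 /h1; rewrite ltxx.
(* If phi y > 0, the ray along a would remain in the constraint set for a short time. *)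
have phiy : phi y = 0.
  apply/eqP; rewrite eq_le phi0 andbT leNgt; apply/negP => phi1.
  apply: (noray _ ha).
  have cphi : phi (s *: a + y) @[s --> 0^'+] --> phi y.
    apply: continuous_cvg; first exact: differentiable_continuous.
    exact: cvg_ray.
  by apply: (cphi [set r | 0 <= r]); apply: filterS (lt_nbhsr phi1) => r /ltW.
split => //; rewrite ltNge; apply/negP => phia.
have {}phib := phib phiy.
(* The perturbation d b is taken so small that h still increases along a + d b. *)
have [d d0 hd] : exists2 d : R, 0 < d & 0 < 'd h y (d *: b + a).
  have : \forall d \near (0 : R)^'+, 0 < d * 'd h y b + 'd h y a.
    have h' : d * 'd h y b + 'd h y a @[d --> 0^'+] --> 'd h y a.
    exact: (@cvg_ray _ R^o ('d h y a) ('d h y b)).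
    by apply: (h' [set r | 0 < r]); exact: lt_nbhsr.
  move=> hd; near (0 : R)^'+ => d; exists d => //.
  rewrite linearD linearZ/=; by near: d.
apply: (noray _ hd); apply: filterS (near_right_gt dphi (_ : 0 < 'd phi y (d *:
  b + a))).
  by move=> s; rewrite phiy => /ltW.
by rewrite linearD linearZ/= ltr_pwDl// mulr_gt0.
Unshelve. all: by end_near. Qed.

(** A one-sided form of Danskin's theorem. Near a point with H (q z) < M continuity suffices. Near a
    point with value M the derivative along w stays negative for small s, and the mean value theorem
    gives a value below H (q z) <= M. Compactness makes t uniform. *)
Lemma perturbed_max_lt {R : realType} {T : topologicalType}
    {E : normedModType R} (H : E -> R) (q w : T -> E) (K : set T) (M : R) :
  compact K -> (forall e, differentiable H e) ->
  continuous (fun p : E * E => 'd H (p.1) p.2) ->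
  continuous q -> continuous w ->
  (forall z, K z -> H (q z) <= M) ->
  (forall z, K z -> H (q z) = M -> 'd H (q z) (w z) < 0) ->
  exists2 t : R, 0 < t & forall z, K z -> H (t *: w z + q z) < M.
Proof.
move=> cK dH cdH cq cw HM HM0.
pose c (p : T * R) := p.2 *: w p.1 + q p.1.
have cc : continuous c.
  move=> p; apply: cvgD.
    apply: cvgZ; first exact: cvg_snd.
    by apply: continuous_cvg; [exact: cw|exact: cvg_fst].
  by apply: continuous_cvg; [exact: cq|exact: cvg_fst].
suff : \forall t \near (0 : R)^'+, K `<=` (fun z => H (t *: w z + q z) < M).
  move=> h; near (0 : R)^'+ => t; exists t => //.
  by near: t.
(* In the near-covering form of compactness it is enough to find, for each z in K, a neighbourhood
   of z and a range of t > 0 on which the bound holds. *)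
move/compact_near_coveringP/near_covering_withinP : cK; apply => z Kz.
have cH : continuous H by move=> e; exact: differentiable_continuous.
have c0 : c (z, 0) = q z by rewrite /c scale0r add0r.
have [zM|zM] := ltP (H (q z)) M.
  have : \forall p \near (z, 0 : R), H (c p) < M.
    have : H (c p) @[p --> (z, 0 : R)] --> H (q z).
      by rewrite -c0; apply: continuous_cvg; [exact: cH|exact: cc].
    by move=> /(_ [set r | r < M]); apply; exact: lt_nbhsl.
  move=> [[A B] /= [Az B0] AB]; exists (A, B) => /=.
    split => //; exact: cvg_within.
  by move=> [y s] /= yAB _; exact: (AB (y, s)).
have zME : H (q z) = M by apply/eqP; rewrite eq_le HM.
have : \forall p \near (z, 0 : R), 'd H (c p) (w p.1) < 0.
  have : 'd H (c p) (w p.1) @[p --> (z, 0 : R)] --> 'd H (q z) (w z).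
    have cwp : (c p, w p.1) @[p --> (z, 0 : R)] --> (c (z, 0), w z).
      apply: cvg_pair; first exact: cc.
      by apply: continuous_cvg; [exact: cw|exact: cvg_fst].
    rewrite -c0; exact: (continuous_cvg _ (cdH (c (z, 0), w z)) cwp).
  by move=> /(_ [set r | r < 0]); apply; apply: lt_nbhsl; exact: HM0.
move=> [[A B] /= [Az /nbhs_ballP[d /= d0 dB]] AB].
(* The value s = 0 has to be excluded, since there H may equal M. *)
exists (A, [set s | 0 < s < d]) => /=.
  split => //; near=> s; apply/andP; split; near: s.
    exact: nbhs_right_gt.
  exact: nbhs_right_lt.
move=> [y s] /= [Ay /andP[s0 sd]] Ky.
have dHc (r : R) : is_derive r 1 (fun s => H (s *: w y + q y)) ('d H (c (y, r))
  (w y)).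
  have aff (h : R) : h *: (1 : R) + r = h + r by rewrite /GRing.scale/= mulr1.
  have affE (h : R) : (h *: (1 : R) + r) *: w y + q y = h *: w y + (r *: w y +
    q y).
    by rewrite aff scalerDl addrA.
  split.
    apply: (@derivable_comp_affine _ _ _ _ (fun s : R => s *: w y + q y) H r 1
      (w y)) => //.
    exact: diff_derivable.
  rewrite -deriveE//.
  exact: (@derive_comp_affine _ _ _ _ (fun s : R => s *: w y + q y) H r 1 (w
    y)).
(* The intermediate parameter satisfies 0 < r < s < d, so the derivative at [c (y, r)] is in the
   range where it is negative. *)
have [r /andP[r0 rs]] := MVT s0 (fun r _ => dHc r)
  (derivable_within_continuous (fun r _ => @ex_derive _ _ _ _ _ _ _ (dHc r))).
rewrite scale0r add0r subr0 => Hr.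
rewrite -subr_gt0; have := HM _ Ky.
have : 'd H (c (y, r)) (w y) < 0.
  apply: (AB (y, r)); split => //=; apply: dB.
  rewrite /ball/= sub0r normrN gtr0_norm//.
  exact: lt_trans sd.
move=> G0; have : 'd H (c (y, r)) (w y) * s < 0 by rewrite nmulr_rlt0.
rewrite -Hr; lra.
Unshelve. all: by end_near. Qed.

(** * Partial derivatives of the Hamiltonian *)

Lemma continuous_sum {R : realType} {T : topologicalType} n (F : 'I_n -> T ->
  R) :
  (forall i, continuous (F i)) -> continuous (fun x => \sum_(i < n) F i x).
Proof.
by move=> cF; apply: continuous_big => //; exact: add_continuous.
Qed.

Section differential_H.
Context {R : realType} {n N : nat}.
Local Notation E := ('M[R]_(N, n) * 'rV[R]_N * 'rV[R]_n)%type.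
Variable H : E -> R.
Hypothesis HC1 : Ck 1 (H : E -> R^o).

Let dH q : differentiable H q. Proof. by case: HC1. Qed.

(** This and the next two lemmas turn the partial derivatives, defined through slices of H, into
    derivatives of H along vectors of the product space with a single nonzero block. *)
Lemma H_PE b j (q : E) : H_P H b j q = 'D_((delta_mx b j, 0, 0) : E) H q.
Proof.
case: q => [[P eta] x]; rewrite /H_P/=.
apply: (derive_comp_affine (phi := fun P => (P, eta, x) : E)) => h.
by rewrite -[RHS]/(h *: delta_mx b j + P, h *: 0 + eta, h *: 0 + x) !scaler0
  !add0r.
Qed.

Lemma H_etaE b (q : E) : H_eta H b q = 'D_((0, basis_vec b, 0) : E) H q.
Proof.
case: q => [[P eta] x]; rewrite /H_eta/=.
apply: (derive_comp_affine (phi := fun eta => (P, eta, x) : E)) => h.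
by rewrite -[RHS]/(h *: 0 + P, h *: basis_vec b + eta, h *: 0 + x) !scaler0
  !add0r.
Qed.

Lemma H_xE i (q : E) : H_x H i q = 'D_((0, 0, basis_vec i) : E) H q.
Proof.
case: q => [[P eta] x]; rewrite /H_x/=.
apply: (derive_comp_affine (phi := fun x => (P, eta, x) : E)) => h.
by rewrite -[RHS]/(h *: 0 + P, h *: 0 + eta, h *: basis_vec i + x) !scaler0
  !add0r.
Qed.

(** Linearity of the differential, after expanding e in the standard basis of the product space. *)
Lemma diff_partialsE (q e : E) : 'd H q e =
  \sum_(b < N) \sum_(j < n) e.1.1 b j * H_P H b j q +
  \sum_(b < N) e.1.2 ord0 b * H_eta H b q +
  \sum_(i < n) e.2 ord0 i * H_x H i q.
Proof.
case: e => [[P eta] x] /=.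
have -> : (P, eta, x) = \sum_b \sum_j P b j *: ((delta_mx b j, 0, 0) : E) +
    \sum_b eta ord0 b *: ((0, basis_vec b, 0) : E) +
    \sum_i x ord0 i *: ((0, 0, basis_vec i) : E).
  have PE : (P, 0, 0) = \sum_b \sum_j P b j *: ((delta_mx b j, 0, 0) : E).
    rewrite {1}(matrix_sum_delta P) (big_morph (fun P => (P, 0, 0) : E)
      (id1 := 0) (op1 := +%R))//; last first.
      by move=> A B; congr (_, _, _); rewrite addr0.
    apply: eq_bigr => b _; rewrite (big_morph (fun P => (P, 0, 0) : E)
      (id1 := 0) (op1 := +%R))//; last first.
      by move=> A B; congr (_, _, _); rewrite addr0.
    by apply: eq_bigr => j _; congr (_, _, _); rewrite scaler0.
  have etaE : (0, eta, 0) = \sum_b eta ord0 b *: ((0, basis_vec b, 0) : E).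
    rewrite {1}(row_sum_delta eta) (big_morph (fun eta => (0, eta, 0) : E)
      (id1 := 0) (op1 := +%R))//; last first.
      by move=> A B; congr (_, _, _); rewrite addr0.
    by apply: eq_bigr => j _; congr (_, _, _); rewrite scaler0.
  have xE : (0, 0, x) = \sum_i x ord0 i *: ((0, 0, basis_vec i) : E).
    rewrite {1}(row_sum_delta x) (big_morph (fun x => (0, 0, x) : E)
      (id1 := 0) (op1 := +%R))//; last first.
      by move=> A B; congr (_, _, _); rewrite addr0.
    by apply: eq_bigr => j _; congr (_, _, _); rewrite scaler0.
  by rewrite -PE -etaE -xE; congr (_, _, _); rewrite /= ?addr0 ?add0r.
rewrite !linearD !linear_sum/=; congr (_ + _ + _).
- apply: eq_bigr => b _; rewrite linear_sum; apply: eq_bigr => j _.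
  by rewrite linearZ/= H_PE deriveE.
- by apply: eq_bigr => b _; rewrite linearZ/= H_etaE deriveE.
- by apply: eq_bigr => b _; rewrite linearZ/= H_xE deriveE.
Qed.

Lemma continuous_H_P b j : continuous (H_P H b j).
Proof.
by case: HC1 => _ /(_ (delta_mx b j, 0, 0)); rewrite (funext (H_PE b j)).
Qed.

(** [Ck] gives continuity in q for each fixed direction only. Joint continuity follows because the
    differential is a finite sum of coordinates of the direction times derivatives along fixed basis
    vectors. *)
Lemma continuous_diff : continuous (fun p : E * E => 'd H (p.1) p.2).
Proof.
have cD (v : E) (l : E -> R) : continuous l ->
    continuous (fun p : E * E => l p.2 * 'D_v H p.1).
  move=> cl p; have [_ /(_ v) cv] := HC1.
  apply: (@continuousM _ _ (l \o snd) ('D_v H \o fst)).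
    by apply: continuous_comp; [exact: cvg_snd|exact: cl].
  by apply: continuous_comp; [exact: cvg_fst|exact: cv].
have coord1 : continuous (fun e : E => e.1.1).
  by move=> e; apply: (@continuous_comp _ _ _ fst fst); exact: cvg_fst.
have coord2 : continuous (fun e : E => e.1.2).
  by move=> e; apply: (@continuous_comp _ _ _ fst snd);
    [exact: cvg_fst|exact: cvg_snd].
rewrite (_ : (fun p => _) = (fun p : E * E =>
  \sum_(b < N) \sum_(j < n) p.2.1.1 b j * 'D_((delta_mx b j, 0, 0) : E) H p.1 +
  \sum_(b < N) p.2.1.2 ord0 b * 'D_((0, basis_vec b, 0) : E) H p.1 +
  \sum_(i < n) p.2.2 ord0 i * 'D_((0, 0, basis_vec i) : E) H p.1)); last first.
  apply/funext => p; rewrite diff_partialsE; congr (_ + _ + _).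
  - by apply: eq_bigr => b _; apply: eq_bigr => j _; rewrite H_PE.
  - by apply: eq_bigr => b _; rewrite H_etaE.
  - by apply: eq_bigr => b _; rewrite H_xE.
have c1 : continuous (fun p : E * E => \sum_(b < N) \sum_(j < n)
    p.2.1.1 b j * 'D_((delta_mx b j, 0, 0) : E) H p.1).
  apply: continuous_sum => b; apply: continuous_sum => j.
  apply: (cD _ (fun e => e.1.1 b j)) => e.
  by apply: (@continuous_comp _ _ _ (fun e : E => e.1.1) (fun P : 'M[R]_(N, n)
    => P b j));
    [exact: coord1|exact: coord_continuous].
have c2 : continuous (fun p : E * E =>
    \sum_(b < N) p.2.1.2 ord0 b * 'D_((0, basis_vec b, 0) : E) H p.1).
  apply: continuous_sum => b.
  apply: (cD _ (fun e => e.1.2 ord0 b)) => e.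
  by apply: (@continuous_comp _ _ _ (fun e : E => e.1.2) (fun P : 'rV[R]_N => P
    ord0 b));
    [exact: coord2|exact: coord_continuous].
have c3 : continuous (fun p : E * E =>
    \sum_(i < n) p.2.2 ord0 i * 'D_((0, 0, basis_vec i) : E) H p.1).
  apply: continuous_sum => i.
  apply: (cD _ (fun e => e.2 ord0 i)) => e.
  by apply: (@continuous_comp _ _ _ snd (fun P : 'rV[R]_n => P ord0 i));
    [exact: cvg_snd|exact: coord_continuous].
by move=> p; exact: (continuousD (continuousD (c1 p) (c2 p)) (c3 p)).
Qed.

End differential_H.

Lemma continuous_pair {T U V : topologicalType} (f : T -> U) (g : T -> V) :
  continuous f -> continuous g -> continuous (fun x => (f x, g x)).
Proof. by move=> cf cg x; apply: cvg_pair; [exact: cf|exact: cg]. Qed.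

(** * The jet of a map and the Aronsson operator as a directional derivative *)

Section jet.
Context {R : realType} {n N : nat}.
Local Notation E := ('M[R]_(N, n) * 'rV[R]_N * 'rV[R]_n)%type.
Implicit Types u g : 'rV[R]_n -> 'rV[R]_N.

Lemma Ck2_Ck1 u : Ck 2 u -> Ck 1 u.
Proof.
by move=> [du Du]; split=> // v z; apply: differentiable_continuous;
  case: (Du v).
Qed.

Lemma gradient_coordE u b j : (forall z, differentiable u z) ->
  (fun z => gradient u z b j) = (fun z => 'D_(basis_vec j) u z ord0 b).
Proof. by move=> du; apply/funext => z; rewrite mxE derive_rV_coord. Qed.

Lemma continuous_gradient u : Ck 1 u -> continuous (gradient u).
Proof.
move=> [du cu]; apply: continuous_mx => b j; rewrite gradient_coordE// => z.
by apply: (@continuous_comp _ _ _ ('D_(basis_vec j) u) (fun v : 'rV[R]_N => v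
  ord0 b));
  [exact: cu|exact: coord_continuous].
Qed.

Lemma gradient_scaleD u g (t : R) z :
  differentiable u z -> differentiable g z ->
  gradient (fun y => u y + t *: g y) z = t *: gradient g z + gradient u z.
Proof.
move=> du dg; apply/matrixP => b j; rewrite !mxE addrC.
have -> : (fun y => (u y + t *: g y) ord0 b) =
    (fun y => u y ord0 b) + t *: (fun y => g y ord0 b).
  by apply/funext => y; rewrite !mxE.
have dub : derivable (fun y => u y ord0 b) z (basis_vec j).
  by apply: diff_derivable; exact: differentiable_rV_coord.
have dgb : derivable (fun y => g y ord0 b) z (basis_vec j).
  by apply: diff_derivable; exact: differentiable_rV_coord.
have dtgb := @derivableZ _ _ _ _ t _ _ dgb.
by rewrite (deriveD dub dtgb) (deriveZ t dgb).
Qed.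

(** The point at which H is evaluated; [H \o jet u] is the function h of the proof idea. *)
Definition jet u z : E := (gradient u z, u z, z).

Section C2.
Variable u : 'rV[R]_n -> 'rV[R]_N.
Hypothesis uC2 : Ck 2 u.

Let du z : differentiable u z. Proof. by case: uC2. Qed.

Lemma differentiable_gradient z : differentiable (gradient u) z.
Proof.
apply: differentiable_mx => b j; rewrite gradient_coordE//.
by apply: differentiable_rV_coord; case: uC2 => _ /(_ (basis_vec j))[].
Qed.

(** This form of the entries yields their continuity from [Ck 2 u]; the one in
    [derive_gradient_hessian] matches the second derivatives in the final system. *)
Lemma derive_gradient v z b j :
  'D_v (gradient u) z b j = 'D_v ('D_(basis_vec j) u) z ord0 b.
Proof.
rewrite derive_mx ?mxE; last exact/diff_derivable/differentiable_gradient.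
by rewrite gradient_coordE// derive_rV_coord//;
  case: uC2 => _ /(_ (basis_vec j))[].
Qed.

Lemma derive_gradient_hessian i z b j :
  'D_(basis_vec i) (gradient u) z b j = hessian u i j b z.
Proof.
rewrite derive_mx ?mxE; last exact/diff_derivable/differentiable_gradient.
suff -> : (fun y => gradient u y b j) =
  'D_(basis_vec j) (fun y => u y ord0 b) by [].
by apply/funext => y; rewrite mxE.
Qed.

Lemma differentiable_jet z : differentiable (jet u) z.
Proof.
apply: (@differentiable_pair _ _ _ _ (fun z => (gradient u z, u z)) id) => //.
by apply: differentiable_pair => //; exact: differentiable_gradient.
Qed.

Lemma derive_jet v z :
  'D_v (jet u) z = ('D_v (gradient u) z, 'D_v u z, v).
Proof.
rewrite !deriveE//; [|exact: differentiable_gradient|exact: differentiable_jet].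
have dg := differentiable_gradient z.
rewrite /jet (@diff_pair _ _ _ _ (fun z => (gradient u z, u z)) id)//;
  last first.
  by apply: differentiable_pair.
by rewrite diff_pair//= diff_val.
Qed.

Lemma continuous_jet : continuous (jet u).
Proof.
by move=> z; apply: differentiable_continuous; exact: differentiable_jet.
Qed.

Lemma continuous_derive_jet v : continuous ('D_v (jet u)).
Proof.
have -> : 'D_v (jet u) = fun z => ('D_v (gradient u) z, 'D_v u z, v).
  by apply/funext => z; exact: derive_jet.
have cg : continuous ('D_v (gradient u)).
  apply: continuous_mx => b j.
  have -> : (fun z => 'D_v (gradient u) z b j) =
      (fun z => 'D_v ('D_(basis_vec j) u) z ord0 b).
    by apply/funext => z; exact: derive_gradient.
  move=> z; apply: (@continuous_comp _ _ _ ('D_v ('D_(basis_vec j) u))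
    (fun v : 'rV[R]_N => v ord0 b)); last exact: coord_continuous.
  by have [_ /(_ (basis_vec j))[_ cD]] := uC2; exact: cD.
have cu : continuous ('D_v u) by case: (Ck2_Ck1 uC2).
apply: (continuous_pair (f := fun z => ('D_v (gradient u) z, 'D_v u z))).
  exact: continuous_pair.
exact: cst_continuous.
Qed.

Variables (H : E -> R) (alpha : 'I_N).
Hypothesis HC1 : Ck 1 (H : E -> R^o).

(** The vector field a of the proof idea, once evaluated along the jet. *)
Definition H_P_row q : 'rV[R]_n := \row_i H_P H alpha i q.

Lemma diff_comp_jetE z : 'd (H \o jet u) z (H_P_row (jet u z)) =
  \sum_(i < n) H_P H alpha i (jet u z) *
    'd H (jet u z) ('D_(basis_vec i) (jet u) z).
Proof.
have [dH _] := HC1; have dj := differentiable_jet z.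
rewrite diff_comp// [in LHS](row_sum_delta (H_P_row _)) linear_sum.
apply: eq_bigr => i _; rewrite linearZ/= mxE deriveE//.
Qed.

Lemma continuous_diff_comp_jet :
  continuous (fun z => 'd (H \o jet u) z (H_P_row (jet u z))).
Proof.
rewrite (funext diff_comp_jetE); apply: continuous_sum => i z.
apply: (@continuousM _ _ (H_P H alpha i \o jet u)
    (fun z => 'd H (jet u z) ('D_(basis_vec i) (jet u) z))).
  by apply: continuous_comp; [exact: continuous_jet|exact: continuous_H_P].
apply: (@continuous_comp _ _ _ (fun z => (jet u z, 'D_(basis_vec i) (jet u) z))
    (fun p : E * E => 'd H (p.1) p.2)); last exact: continuous_diff.
apply: (continuous_pair (f := jet u) (g := 'D_(basis_vec i) (jet u))).
  exact: continuous_jet.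
exact: continuous_derive_jet.
Qed.

(** By the chain rule the left side of the system is the derivative of h along a: the three blocks
    of the derivative of the jet along [basis_vec i] produce the second-order term, the H_eta term
    and the H_x term. *)
Lemma diff_comp_jet_aronsson z : 'd (H \o jet u) z (H_P_row (jet u z)) =
  \sum_(beta < N) \sum_(i < n) \sum_(j < n)
    (H_P H alpha i (jet u z) * H_P H beta j (jet u z) * hessian u i j beta z)
  + \sum_(i < n) H_P H alpha i (jet u z) *
      (\sum_(beta < N) H_eta H beta (jet u z) * gradient u z beta i +
       H_x H i (jet u z)).
Proof.
rewrite diff_comp_jetE exchange_big -big_split/=; apply: eq_bigr => i _.
rewrite derive_jet diff_partialsE//= -addrA mulrDr; congr (_ + _).
  rewrite mulr_sumr; apply: eq_bigr => b _; rewrite mulr_sumr.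
  apply: eq_bigr => j _; rewrite derive_gradient_hessian -mulrA.
  by congr (_ * _); exact: mulrC.
congr (_ * (_ + _)).
  by apply: eq_bigr => b _; rewrite mulrC mxE derive_rV_coord.
rewrite (bigD1 i)//= big1 => [|j ji]; rewrite /basis_vec mxE eqxx/=.
  by rewrite eqxx mul1r addr0.
by rewrite (negbTE ji) mul0r.
Qed.

End C2.
End jet.

(** * The quadratic test map *)

Section paraboloid.
Context {R : realType} {n : nat}.
Variables (x : 'rV[R]_n) (r : R).

(** The function phi of the proof idea. The norm of ['rV[R]_n] is the sup norm, so the squared
    Euclidean distance is written out as a sum. *)
Definition paraboloid (z : 'rV[R]_n) : R :=
  r ^+ 2 - \sum_(i < n) (z ord0 i - x ord0 i) ^+ 2.

Let sq (i : 'I_n) : 'rV[R]_n -> R := (fun y => y ord0 i - x ord0 i) ^+ 2.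

Let paraboloidE : paraboloid = cst (r ^+ 2) - \sum_(i < n) sq i.
Proof.
apply/funext => y; rewrite /paraboloid !fctE fct_sumE; congr (_ - _).
Qed.

Let differentiable_sq i z : differentiable (sq i) z.
Proof.
apply: (@differentiableX _ _ (fun y : 'rV[R]_n => y ord0 i - x ord0 i) 1%N).
apply: (@differentiableB _ _ _ (fun y : 'rV[R]_n => y ord0 i) (cst _)) => //.
exact: differentiable_coord.
Qed.

Lemma differentiable_paraboloid z : differentiable paraboloid z.
Proof.
rewrite paraboloidE; apply: differentiableB => //.
by apply: differentiable_sum => i; exact: differentiable_sq.
Qed.

Lemma derive_paraboloid v z :
  'D_v paraboloid z = - 2 * \sum_(i < n) v ord0 i * (z ord0 i - x ord0 i).
Proof.
rewrite paraboloidE deriveB//; last first.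
  by apply: derivable_sum => i; exact: diff_derivable.
rewrite derive_cst sub0r derive_sum => [|i]; last exact: diff_derivable.
rewrite mulNr mulr_sumr; congr (- _); apply: eq_bigr => i _.
have dc : derivable (fun y : 'rV[R]_n => y ord0 i) z v.
  by apply: diff_derivable; exact: differentiable_coord.
rewrite /sq (@deriveX _ _ (fun y : 'rV[R]_n => y ord0 i - x ord0 i) 2%N);
  last exact: derivableB.
rewrite (@deriveB _ _ _ (fun y : 'rV[R]_n => y ord0 i) (cst (x ord0 i)))//.
rewrite derive_cst subr0 derive_rV_coord// derive_id expr1.
by rewrite /GRing.scale/= -mulr_natl; ring.
Qed.

Lemma paraboloid_Ck1 : Ck 1 (paraboloid : _ -> R^o).
Proof.
split => [z|v]; first exact: differentiable_paraboloid.
have -> : (fun z => 'D_v paraboloid z) =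
    (fun z => - 2 * \sum_(i < n) v ord0 i * (z ord0 i - x ord0 i)).
  by apply/funext => z; exact: derive_paraboloid.
move=> z; apply: (@continuousM _ _ (cst (- 2))); first exact: cst_continuous.
apply: continuous_sum => i y; apply: (@continuousM _ _ (cst (v ord0 i))
    (fun y : 'rV[R]_n => y ord0 i - x ord0 i)).
  exact: cst_continuous.
apply: (@continuousB _ _ _ (fun y : 'rV[R]_n => y ord0 i) (cst (x ord0 i))).
  exact: coord_continuous.
exact: cst_continuous.
Qed.

Lemma continuous_paraboloid : continuous paraboloid.
Proof.
by move=> z; apply: differentiable_continuous; exact: differentiable_paraboloid.
Qed.

(** The sup norm is dominated by the Euclidean norm: each squared coordinate is at most the whole
    sum. *)
Lemma paraboloid_ge0_norm z : 0 < r -> 0 <= paraboloid z -> `|x - z| <= r.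
Proof.
rewrite /paraboloid subr_ge0 => r0 zr; apply: norm_rV_le => [|i];
  first exact: ltW.
rewrite !mxE distrC -(ler_pXn2r (_ : 0 < 2)%N) ?nnegrE ?(ltW r0)//.
rewrite real_normK ?num_real// (le_trans _ zr)// (bigD1 i)//= lerDl.
by apply: sumr_ge0 => j _; exact: sqr_ge0.
Qed.

Lemma paraboloid_center : paraboloid x = r ^+ 2.
Proof.
by rewrite /paraboloid big1 ?subr0// => i _; rewrite subrr expr0n.
Qed.

(** Both sides are twice the squared Euclidean distance from x to z. On the sphere this is 2 r^2 >
    0, so x - z is the inward direction needed at a constrained maximum. *)
Lemma derive_paraboloid_center z :
  'D_(x - z) paraboloid z = 2 * (r ^+ 2 - paraboloid z).
Proof.
rewrite derive_paraboloid /paraboloid opprB addrCA subrr addr0 mulNr -mulrN.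
congr (_ * _); rewrite -sumrN; apply: eq_bigr => i _.
by rewrite !mxE; ring.
Qed.

Hypothesis r0 : 0 < r.

Lemma bounded_paraboloid : bounded_set [set z | 0 <= paraboloid z].
Proof.
exists (`|x| + r); split => [|s sr z /= zr]; first exact: num_real.
rewrite (le_trans _ (ltW sr))//.
have -> : z = x - (x - z) by rewrite opprB addrCA subrr addr0.
by rewrite (le_trans (ler_normB _ _))// lerD2l paraboloid_ge0_norm.
Qed.

Lemma bounded_open_paraboloid : bounded_open [set z | 0 < paraboloid z].
Proof.
split.
  apply: (@open_comp _ _ paraboloid [set s | 0 < s]); last exact: open_gt.
  by move=> z _; exact: continuous_paraboloid.
have [M [Mr hM]] := bounded_paraboloid; exists M; split => // s Ms z /ltW.
exact: hM.
Qed.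

Lemma compact_paraboloid : compact [set z | 0 <= paraboloid z].
Proof.
apply: bounded_closed_compact; first exact: bounded_paraboloid.
apply: (@closed_comp _ _ paraboloid [set s | 0 <= s]); last exact: closed_ge.
by move=> z _; exact: continuous_paraboloid.
Qed.

End paraboloid.

Section Ck1_scale.
Context {R : realType} {V W : normedModType R}.

Lemma Ck1_scaler (c : R) (f : V -> W) : Ck 1 f -> Ck 1 (fun z => c *: f z).
Proof.
move=> [df cf]; split => [z|v z]; first exact: differentiableZ.
have -> : (fun z => 'D_v (fun z => c *: f z) z) = c \*: 'D_v f.
  by apply/funext => y; apply: (deriveZ (f := f)); exact: diff_derivable.
by apply: cvgZl_tmp; exact: cf.
Qed.

Lemma derive_scalel (k : V -> R) (a : W) v z : differentiable k z ->
  'D_v (fun z => k z *: a) z = 'D_v k z *: a.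
Proof.
move=> dk; rewrite deriveE; last exact: differentiableZl.
by rewrite diffZl//= deriveE.
Qed.

Lemma Ck1_scalel (k : V -> R) (a : W) :
  Ck 1 (k : V -> R^o) -> Ck 1 (fun z => k z *: a).
Proof.
move=> [dk ck]; split => [z|v z]; first exact: differentiableZl.
have -> : (fun z => 'D_v (fun z => k z *: a) z) = (fun z => 'D_v k z *: a).
  by apply/funext => y; exact: derive_scalel.
by apply: cvgZr_tmp; exact: ck.
Qed.

Lemma continuous_scalel (t : R) (k : V -> R) (a : W) :
  continuous k -> continuous (fun z => t *: (k z *: a)).
Proof.
by move=> ck z; apply: cvgZl_tmp; apply: cvgZr_tmp; exact: ck.
Qed.

End Ck1_scale.

Section bump.
Context {R : realType} {n N : nat}.
Variables (x : 'rV[R]_n) (r c : R) (alpha : 'I_N).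
Hypothesis r0 : 0 < r.

(** The test map g, not cut off outside the ball: it is C^1 on the whole space, and membership in
    [W1infty0] concerns only its values inside. *)
Definition bump (z : 'rV[R]_n) : 'rV[R]_N :=
  c *: (paraboloid x r z *: basis_vec alpha).

Lemma bump_Ck1 : Ck 1 bump.
Proof. by apply: Ck1_scaler; apply: Ck1_scalel; exact: paraboloid_Ck1. Qed.

Lemma gradient_bumpE z b j : gradient bump z b j =
  c * 'D_(basis_vec j) (paraboloid x r) z * (b == alpha)%:R.
Proof.
have [db _] := bump_Ck1.
have [dk _] := Ck1_scalel (basis_vec alpha : 'rV[R]_N) (paraboloid_Ck1 x r).
rewrite mxE derive_rV_coord// (deriveZ (f := fun z => _ *: _)); last first.
  exact: diff_derivable.
rewrite derive_scalel; last exact: differentiable_paraboloid.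
by rewrite /basis_vec !mxE eqxx mulrA.
Qed.

Lemma bump_W1infty0 (t : R) :
  W1infty0 [set z | 0 < paraboloid x r z] (fun z => t *: bump z).
Proof.
split.
  apply: C1_W1infty; first exact: bounded_open_paraboloid.
  by apply: Ck1_scaler; exact: bump_Ck1.
(* The positive part of the paraboloid gives the extension by zero. *)
exists (fun z => t *: (c *: (Num.max (paraboloid x r z) 0 *: basis_vec alpha))).
split.
- have ck : continuous (fun z => Num.max (paraboloid x r z) 0 : R^o).
    move=> z; apply: (@continuous_max _ _ (paraboloid x r) (cst 0)).
      exact: continuous_paraboloid.
    exact: cst_continuous.
  rewrite (_ : (fun z => _) = (fun z => (t * c) *:
      (Num.max (paraboloid x r z) 0 *: (basis_vec alpha : 'rV[R]_N)))).
    exact: continuous_scalel.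
  by apply/funext => z; rewrite scalerA.
- move=> z /negP; rewrite -leNgt => z0.
  by rewrite max_r// scale0r !scaler0.
- by apply: aeW => z /ltW z0; rewrite max_l.
Qed.

End bump.

Lemma continuous_scaleD {R : realType} {T : topologicalType}
    {V : normedModType R} (t : R) (f g : T -> V) :
  continuous f -> continuous g -> continuous (fun z => t *: f z + g z).
Proof.
move=> cf cg z; apply: cvgD; last exact: cg.
by apply: cvgZl_tmp; exact: cf.
Qed.

(** * Minimality against the test map and the contradiction *)

Section absolutely_minimizing.
Context {R : realType} {n N : nat}.
Local Notation E := ('M[R]_(N, n) * 'rV[R]_N * 'rV[R]_n)%type.
Variables (H : E -> R) (u : 'rV[R]_n -> 'rV[R]_N).
Hypothesis HC1 : Ck 1 (H : E -> R^o).
Hypothesis uAM : absolutely_minimizing H u.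
Hypothesis uC2 : Ck 2 u.

Let du z : differentiable u z. Proof. by case: uC2. Qed.

Let cH : continuous H.
Proof. by move=> q; apply: differentiable_continuous; case: HC1. Qed.

(** The increment of the jet: u + t g has jet [jet u] plus t times this. The last block is 0 because
    the base point does not move. *)
Definition bump_jet x r c (alpha : 'I_N) (z : 'rV[R]_n) : E :=
  (gradient (bump x r c alpha) z, bump x r c alpha z, 0).

Lemma continuous_bump_jet x r c (alpha : 'I_N) :
  continuous (bump_jet x r c alpha).
Proof.
have bC1 := bump_Ck1 x r c alpha; rewrite /bump_jet.
apply: (continuous_pair (f := fun z => (gradient (bump x r c alpha) z,
    bump x r c alpha z)) (g := cst (0 : 'rV[R]_n))); last exact: cst_continuous.
apply: continuous_pair; first exact: continuous_gradient.
by move=> z; apply: differentiable_continuous; case: bC1.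
Qed.

(** Where phi vanishes so does the value of g, and only row alpha of its gradient, namely c D phi,
    is left; pairing it with H_P gives the derivative of phi along c a. *)
Lemma diff_bump_jet x r c (alpha : 'I_N) q z : paraboloid x r z = 0 ->
  'd H q (bump_jet x r c alpha z) =
  'd (paraboloid x r) z (c *: H_P_row H alpha q).
Proof.
move=> z0; rewrite diff_partialsE//= [X in _ + X]big1 => [|i _]; last first.
  by rewrite mxE mul0r.
rewrite [X in _ + X + _]big1 => [|b _]; last first.
  by rewrite /bump z0 scale0r scaler0 mxE mul0r.
rewrite !addr0 (bigD1 alpha)//= [X in _ + X]big1 => [|b ba]; last first.
  by apply: big1 => j _; rewrite gradient_bumpE (negbTE ba) mulr0 mul0r.
rewrite addr0 linearZ/= [X in 'd _ _ X](row_sum_delta (H_P_row H alpha q)).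
rewrite linear_sum/= /GRing.scale/= mulr_sumr; apply: eq_bigr => j _.
rewrite gradient_bumpE eqxx mulr1 linearZ/= mxE deriveE; last first.
  exact: differentiable_paraboloid.
by rewrite /GRing.scale/=; ring.
Qed.

(** Minimality bounds the essential supremum for u by that for u + t g, hence by M; continuity of
    [H \o jet u] turns this into a bound at every point of the open ball. *)
Lemma absolutely_minimizing_bump x r c (alpha : 'I_N) (t M : R) : 0 < r ->
  (forall z, 0 < paraboloid x r z ->
    H (t *: bump_jet x r c alpha z + jet u z) <= M) ->
  forall z, 0 < paraboloid x r z -> H (jet u z) <= M.
Proof.
move=> r0 HM; set g := bump x r c alpha.
have bO := @bounded_open_paraboloid R n x r r0.
have [dg _] := bump_Ck1 x r c alpha.
have uC1 := Ck2_Ck1 uC2.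
have tgC1 : Ck 1 (fun z => t *: g z) by apply: Ck1_scaler; exact: bump_Ck1.
have ugC1 : Ck 1 (fun z => u z + t *: g z).
  have [_ cu] := uC1; have [dtg ctg] := tgC1.
  split => [z|v]; first exact: differentiableD.
  have -> : (fun z => 'D_v (fun z => u z + t *: g z) z) =
      'D_v u \+ 'D_v (fun z => t *: g z).
    by apply/funext => z; apply: (deriveD (f := u)); exact: diff_derivable.
  by move=> z; apply: continuousD; [exact: cu|exact: ctg].
have [_ uM] := uAM.
(* The classical gradients of u and u + t g are admissible as weak gradients, both maps being
   C^1. *)
have := uM _ bO _ (bump_W1infty0 x c alpha r0 t) _ _
  (C1_weak_gradient bO uC1) (C1_weak_gradient bO ugC1).
rewrite /E_infty => Eu.
apply: le_of_ess_sup_on; first by case: bO.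
  by move=> z; apply: continuous_comp; [exact: continuous_jet|exact: cH].
apply: (le_trans Eu); apply: ess_sup_on_le => z z0.
rewrite gradient_scaleD//; apply: le_trans (HM _ z0).
rewrite le_eqVlt; apply/orP; left; apply/eqP; congr H.
rewrite -[RHS]/(t *: gradient g z + gradient u z, t *: g z + u z, t *: 0 + z).
by rewrite scaler0 add0r [t *: g z + _]addrC.
Qed.

Lemma diff_comp_jet_eq0 (alpha : 'I_N) x :
  'd (H \o jet u) x (H_P_row H alpha (jet u x)) = 0.
Proof.
pose A z := 'd (H \o jet u) z (H_P_row H alpha (jet u z)).
have [//|A0] := eqVneq (A x) 0; exfalso.
(* With this sign, c A(x) = |A(x)| > 0. *)
pose c := Num.sg (A x).
have cA0 : 0 < c * A x by rewrite /c -normrEsg normr_gt0.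
have : \forall z \near x, 0 < c * A z.
  have cA : continuous A by exact: continuous_diff_comp_jet.
  have ccA : c * A z @[z --> x] --> c * A x 
    by apply: (@continuousM _ _ (cst c) A x); [exact: cst_continuous|exact: cA].
  by apply: (ccA [set s | 0 < s]); exact: lt_nbhsr.
move=> /nbhs_normP[e /= e0 eA].
(* Halving e puts the closed Euclidean ball of radius r inside the open norm ball on which c A is
   positive. *)
pose r := e / 2; have r0 : 0 < r by rewrite divr_gt0.
set phi := paraboloid x r; pose K := [set z | 0 <= phi z].
have KA z : K z -> 0 < c * A z.
  move=> Kz; apply: eA => /=; apply: le_lt_trans (paraboloid_ge0_norm r0 Kz) _.
  by rewrite /r; lra.
have cK : compact K by exact: compact_paraboloid.
have Kx : K x by rewrite /K/= /phi paraboloid_center exprn_ge0// ltW.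
have ch : continuous (H \o jet u).
  by move=> z; apply: continuous_comp; [exact: continuous_jet|exact: cH].
have [y /set_mem Ky ymax] := compact_EVT_max (ex_intro _ x Kx) cK
  (continuous_subspaceT ch).
have dh z : differentiable (H \o jet u) z.
  by apply: differentiable_comp; [exact: differentiable_jet|case: HC1].
have dphi z : differentiable phi z by exact: differentiable_paraboloid.
have phib z : phi z = 0 -> 0 < 'd phi z (x - z).
  move=> z0; rewrite -deriveE// derive_paraboloid_center -/phi z0 subr0.
  by rewrite mulr_gt0// exprn_gt0.
(* This is required at every maximum point, not only at y: the perturbation has to lower H at all of
   them. *)
have outward z : K z -> H (jet u z) = H (jet u y) ->
    phi z = 0 /\ 'd phi z (c *: H_P_row H alpha (jet u z)) < 0.
  move=> Kz zy; apply: constrained_max_outward (phib z) => //.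
    by move=> z' Kz'; rewrite /= zy; apply: ymax; rewrite inE.
  by rewrite linearZ/=; exact: KA.
have [||||||t t0 ht] := @perturbed_max_lt _ _ _ H (jet u)
    (bump_jet x r c alpha) K (H (jet u y)) cK.
- by case: HC1.
- exact: continuous_diff.
- exact: continuous_jet.
- exact: continuous_bump_jet.
- by move=> z Kz; apply: ymax; rewrite inE.
- by move=> z Kz /(outward _ Kz)[z0 hz]; rewrite diff_bump_jet.
pose F z := H (t *: bump_jet x r c alpha z + jet u z).
have cF : continuous F.
  move=> z; apply: (@continuous_comp _ _ _
    (fun z => t *: bump_jet x r c alpha z + jet u z) H); last exact: cH.
  apply: (continuous_scaleD (f := bump_jet x r c alpha) (g := jet u)).
    exact: continuous_bump_jet.
  exact: continuous_jet.
(* The maximum of F over K is attained, so a single number F y' bounds F and is still strictly below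
   H (jet u y). *)
have [y' /set_mem Ky' y'max] := compact_EVT_max (ex_intro _ x Kx) cK
  (continuous_subspaceT cF).
have hM : forall z, 0 < phi z -> H (jet u z) <= F y'.
  apply: (absolutely_minimizing_bump (t := t) (c := c) (alpha := alpha)) => //.
  by move=> z /ltW Kz; apply: y'max; rewrite inE.
have y0 : phi y = 0 by have [] := outward y Ky erefl.
(* Minimality controls only the open ball, whereas y lies on its boundary. Points on the inward ray
   from y are in the open ball, and h there tends to H (jet u y) > F y', which contradicts [hM]. *)
have h1 : \forall s \near (0 : R)^'+, 0 < phi (s *: (x - y) + y).
  by have := near_right_gt (dphi y) (phib y y0); rewrite y0.
have h2 : \forall s \near (0 : R)^'+, F y' < H (jet u (s *: (x - y) + y)).
  have hs : (H \o jet u) (s *: (x - y) + y) @[s --> (0 : R)^'+] --> H (jet u y).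
    by apply: continuous_cvg; [exact: ch|exact: cvg_ray].
  by apply: (hs [set s | F y' < s]); apply: lt_nbhsr; exact: ht.
have [s [/hM s1 s2]] := filter_ex (filterI h1 h2).
by have := lt_le_trans s2 s1; rewrite ltxx.
Qed.

End absolutely_minimizing.

Theorem theorem2p1 (R : realType) (n N : nat)
    (H : 'M[R]_(N, n) * 'rV[R]_N * 'rV[R]_n -> R)
    (HC1 : Ck 1 (H : 'M[R]_(N, n) * 'rV[R]_N * 'rV[R]_n -> R^o))
    (Hge0 : forall q, 0 <= H q)
    (u : 'rV[R]_n -> 'rV[R]_N)
    (uAM : absolutely_minimizing H u)
    (uC2 : Ck 2 u)
    (alpha : 'I_N) (x : 'rV[R]_n) :
  let q := (gradient u x, u x, x) in
  \sum_(beta < N) \sum_(i < n) \sum_(j < n)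
    (H_P H alpha i q * H_P H beta j q * hessian u i j beta x)
  + \sum_(i < n) H_P H alpha i q *
      (\sum_(beta < N) H_eta H beta q * gradient u x beta i + H_x H i q) = 0.
Proof.
by move=> q; rewrite -(diff_comp_jet_aronsson uC2 alpha HC1) diff_comp_jet_eq0.
Qed.
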